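(* Let $f:\mathbb{R}^n\to\mathbb{R}$ be twice continuously differentiable, let $\mathbf{x}_k\in\mathbb{R}^n$ be any point, $\mathbf{g}_k=\nabla f(\mathbf{x}_k)$, $\varepsilon_k\in(0,1)$ and $\xi_k>0$. Let $S_k\in\mathbb{R}^{n\times n}$ be any symmetric matrix that is not a multiple of the identity $I$, and let $\mathbf{d}_k^{\mathrm{NT}}$ be a solution of the linear system $S_k\mathbf{d}=-\mathbf{g}_k$. Assume that $$-\mathbf{g}_k^\top\mathbf{d}_k^{\mathrm{NT}}<\varepsilon_k\,\|\mathbf{g}_k\|\,\|\mathbf{d}_k^{\mathrm{NT}}\|.$$ For $\beta_k\in[0,1]$ define $$\mathbf{d}_k=\beta_k\,\mathbf{d}_k^{\mathrm{NT}}-(1-\beta_k)\,\xi_k\,\mathbf{g}_k .$$ (i) Let $\beta_k^\varepsilon$ be the smallest root in $(0,1)$ of the polynomial $P_k(\beta)=A_k\beta^2+B_k\beta+C_k$, where $$A_k=\left(\mathbf{g}_k^\top\mathbf{d}_k^{\mathrm{NT}}\right)^2-\varepsilon_k^2\|\mathbf{g}_k\|^2\|\mathbf{d}_k^{\mathrm{NT}}\|^2-B_k-C_k,$$ $$B_k=-2(1-\varepsilon_k^2)\,\xi_k\|\mathbf{g}_k\|^2\left(\xi_k\|\mathbf{g}_k\|^2+\mathbf{g}_k^\top\mathbf{d}_k^{\mathrm{NT}}\right),$$ $$C_k=(1-\varepsilon_k^2)\,\xi_k^2\|\mathbf{g}_k\|^4 .$$ If $\mathbf{d}_k$ is defined with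 $\beta_k=\beta_k^\varepsilon$, then $-\mathbf{g}_k^\top\mathbf{d}_k=\varepsilon_k\|\mathbf{g}_k\|\,\|\mathbf{d}_k\|$. (ii) For $\mathbf{d}_k=\beta_k\,\mathbf{d}_k^{\mathrm{NT}}-(1-\beta_k)\,\xi_k\,\mathbf{g}_k$ with $\beta_k\in[0,1]$, one has $$-\mathbf{g}_k^\top\mathbf{d}_k\ge\varepsilon_k\|\mathbf{g}_k\|\,\|\mathbf{d}_k\|$$ if and only if $\beta_k\le\beta_k^\varepsilon$. (iii) A lower bound for $\beta_k^\varepsilon$ (that is, $\hat\beta_k\le\beta_k^\varepsilon$) is provided by $$\hat\beta_k=\frac{\rho_k}{\rho_k+\pi_k},\qquad \rho_k=\xi_k(1-\varepsilon_k),\qquad \pi_k=\frac{\mathbf{g}_k^\top\mathbf{d}_k^{\mathrm{NT}}}{\|\mathbf{g}_k\|^2}+\varepsilon_k\frac{\|\mathbf{d}_k^{\mathrm{NT}}\|}{\|\mathbf{g}_k\|}.$$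
   Context: $\|\cdot\|$ denotes the Euclidean norm on $\mathbb{R}^n$. The index $k$ is fixed (it labels an iteration of a line-search method) and plays no role beyond notation. *)

(* Defs.v *)
From HB Require Import structures.
From mathcomp Require Import all_boot all_order all_algebra.
From mathcomp Require Import all_classical all_reals all_analysis.
Set Implicit Arguments.
Unset Strict Implicit.
Unset Printing Implicit Defensive.
Import Order.TTheory GRing.Theory Num.Theory.
Import numFieldNormedType.Exports.
Local Open Scope ring_scope.

(* Points of R^n are column vectors.  The norm that MathComp-Analysis puts on
   'cV[R]_n is the sup norm; it is used below only through the topology and
   the differential structure it induces, which are those of the Euclidean
   norm [enorm]. *)

Definition dot (R : realType) (n : nat) (u v : 'cV[R]_n) : R :=
  \sum_(i < n) u i ord0 * v i ord0.

Definition enorm (R : realType) (n : nat) (u : 'cV[R]_n) : R :=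
  Num.sqrt (dot u u).

Definition grad (R : realType) (n : nat) (f : 'cV[R]_n -> R) (x : 'cV[R]_n) :
    'cV[R]_n :=
  \col_(i < n) 'D_(delta_mx i ord0) f x.

Definition hess (R : realType) (n : nat) (f : 'cV[R]_n -> R) (x : 'cV[R]_n) :
    'M[R]_n :=
  \matrix_(i < n, j < n) 'D_(delta_mx j ord0) ('D_(delta_mx i ord0) f) x.

Definition twice_continuously_differentiable (R : realType) (n : nat)
    (f : 'cV[R]_n -> R) : Prop :=
  [/\ forall x, differentiable f x,
      forall x, differentiable (grad f) x
    & continuous (hess f)].

(* With d(beta) := direction xi g d beta (defined last), angle_poly is the
   expansion in beta of
     (dot g d(beta))^2 - eps^2 * |g|^2 * |d(beta)|^2. *)

Definition angle_coefC (R : realType) (n : nat) (eps xi : R) (g : 'cV[R]_n) :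
    R :=
  (1 - eps ^+ 2) * xi ^+ 2 * enorm g ^+ 4.

Definition angle_coefB (R : realType) (n : nat) (eps xi : R)
    (g d : 'cV[R]_n) : R :=
  - 2 * (1 - eps ^+ 2) * xi * enorm g ^+ 2 * (xi * enorm g ^+ 2 + dot g d).

Definition angle_coefA (R : realType) (n : nat) (eps xi : R)
    (g d : 'cV[R]_n) : R :=
  dot g d ^+ 2 - eps ^+ 2 * enorm g ^+ 2 * enorm d ^+ 2
  - angle_coefB eps xi g d - angle_coefC eps xi g.

Definition angle_poly (R : realType) (n : nat) (eps xi : R) (g d : 'cV[R]_n) :
    {poly R} :=
  angle_coefA eps xi g d *: 'X^2 + angle_coefB eps xi g d *: 'X
  + (angle_coefC eps xi g)%:P.

Definition smallest_root01 (R : realType) (p : {poly R}) (b : R) : Prop :=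
  [/\ 0 < b < 1, root p b
    & forall c : R, 0 < c < 1 -> root p c -> b <= c].

Definition direction (R : realType) (n : nat) (xi : R) (g d : 'cV[R]_n)
    (beta : R) : 'cV[R]_n :=
  beta *: d - ((1 - beta) * xi) *: g.

(* Main.v *)
Require Import Defs.
From HB Require Import structures.
From mathcomp Require Import all_boot all_order all_algebra.
From mathcomp Require Import all_classical all_reals all_analysis.
From mathcomp Require Import ring lra.
Import Order.TTheory GRing.Theory Num.Theory.
Import numFieldNormedType.Exports.
Local Open Scope ring_scope.

(** Write [slack eps g v] for [- g.v - eps |g| |v|], which is nonnegative
    exactly when [v] makes a good enough angle with the steepest descent
    direction [- g].  It is a linear form minus a nonnegative multiple of the
    Euclidean norm, hence superadditive and positively homogeneous.  As
    [direction xi g d beta] is the convex combination of [d] and [- xi g] with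
    weights [beta] and [1 - beta], the map
    [F beta := slack eps g (direction xi g d beta)] is concave.  It is positive
    at 0, where the direction is a multiple of [- g], and the angle hypothesis
    says that it is negative at 1; so it vanishes at some [b] in ]0, 1[, it is
    positive before [b] and negative after [b] ([concave_sign_before],
    [concave_sign_after]).

    The polynomial factors as [P = F * (F + 2 eps |g| |direction|)]
    ([horner_angle_poly]).  Its second factor may vanish too, when the direction
    makes the same angle with [+ g]; but it is at least [F], so [P] is positive
    wherever [F] is.  Hence [b] is the smallest root of [P] in ]0, 1[
    ([smallest_root01_slack_root]), so [F] vanishes at that root, which is (i),
    and (ii) is the sign of [F].  For (iii), the concavity of [F] bounds it
    below by its chord between 0 and 1, whose zero is
    [rho / (rho + pi)]; so [F] is nonnegative there and (ii) applies. *)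

(** * Euclidean inner product and norm *)

Lemma dotDl {R : realType} {n : nat} (u v w : 'cV[R]_n) :
  dot (u + v) w = dot u w + dot v w.
Proof.
by rewrite /dot -big_split; apply: eq_bigr => i _ /=; rewrite mxE mulrDl.
Qed.

Lemma dotZl {R : realType} {n : nat} (a : R) (u v : 'cV[R]_n) :
  dot (a *: u) v = a * dot u v.
Proof.
by rewrite /dot mulr_sumr; apply: eq_bigr => i _; rewrite mxE mulrA.
Qed.

Lemma dotC {R : realType} {n : nat} (u v : 'cV[R]_n) : dot u v = dot v u.
Proof. by apply: eq_bigr => i _; rewrite mulrC. Qed.

Lemma dotDr {R : realType} {n : nat} (u v w : 'cV[R]_n) :
  dot w (u + v) = dot w u + dot w v.
Proof. by rewrite dotC dotDl !(dotC _ w). Qed.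

Lemma dotZr {R : realType} {n : nat} (a : R) (u v : 'cV[R]_n) :
  dot u (a *: v) = a * dot u v.
Proof. by rewrite dotC dotZl dotC. Qed.

Lemma dot_ge0 {R : realType} {n : nat} (u : 'cV[R]_n) : 0 <= dot u u.
Proof. by apply: sumr_ge0 => i _; rewrite -expr2 sqr_ge0. Qed.

Lemma enorm_ge0 {R : realType} {n : nat} (u : 'cV[R]_n) : 0 <= enorm u.
Proof. exact: sqrtr_ge0. Qed.

Lemma enorm_sqr {R : realType} {n : nat} (u : 'cV[R]_n) :
  enorm u ^+ 2 = dot u u.
Proof. by rewrite sqr_sqrtr // dot_ge0. Qed.

Lemma enormZ {R : realType} {n : nat} (a : R) (u : 'cV[R]_n) :
  enorm (a *: u) = `|a| * enorm u.
Proof.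
by rewrite /enorm dotZl dotZr mulrA -expr2 sqrtrM ?sqr_ge0// sqrtr_sqr.
Qed.

(** Cauchy-Schwarz, from the nonnegativity of the squared norm of
    [|v| u - |u| v], which is [2 |u| |v| (|u| |v| - u.v)]; the vanishing of the
    factor [|u| |v|] has to be treated apart. *)
Lemma dot_le_enorm {R : realType} {n : nat} (u v : 'cV[R]_n) :
  dot u v <= enorm u * enorm v.
Proof.
have eq0 (w : 'cV[R]_n) : enorm w = 0 -> w = 0.
  move=> w0; apply/matrixP => i j; rewrite (ord1 j) mxE.
  have /eqP : dot w w = 0 by rewrite -enorm_sqr w0 expr0n.
  rewrite psumr_eq0 => [|k _]; last by rewrite -expr2 sqr_ge0.
  by move=> /allP/(_ i (mem_index_enum i)); rewrite /= mulf_eq0 orbb => /eqP.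
have dot0l (w : 'cV[R]_n) : dot 0 w = 0.
  by rewrite -(scale0r 0) dotZl mul0r.
have [u0|u_neq0] := eqVneq (enorm u) 0.
  by rewrite u0 mul0r (eq0 u u0) dot0l.
have [v0|v_neq0] := eqVneq (enorm v) 0.
  by rewrite v0 mulr0 (eq0 v v0) dotC dot0l.
have uv_gt0 : 0 < enorm u * enorm v.
  by rewrite mulr_gt0 // lt_neqAle eq_sym enorm_ge0 ?u_neq0 ?v_neq0.
have := dot_ge0 (enorm v *: u + (- enorm u) *: v).
rewrite dotDl !dotDr !dotZl !dotZr (dotC v u) -!enorm_sqr => sq_ge0.
rewrite -(ler_pM2l uv_gt0).
lra.
Qed.

Lemma enormD {R : realType} {n : nat} (u v : 'cV[R]_n) :
  enorm (u + v) <= enorm u + enorm v.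
Proof.
rewrite -(@ler_pXn2r _ 2) // ?nnegrE ?addr_ge0 ?enorm_ge0//.
rewrite enorm_sqr dotDl !dotDr (dotC v u) sqrrD !enorm_sqr.
have := dot_le_enorm u v; lra.
Qed.

(** * Positive before a zero and negative after it: concave functions *)

Definition concave {R : realType} (F : R -> R) : Prop :=
  forall t x y : R, 0 <= t <= 1 ->
    t * F x + (1 - t) * F y <= F (t * x + (1 - t) * y).

Lemma concave_sign_before {R : realType} (F : R -> R) (b c : R) :
  concave F -> 0 < F 0 -> F b = 0 -> 0 <= c < b -> 0 < F c.
Proof.
move=> Fconc F0 Fb /andP[c0 cb].
have b0 : 0 < b by exact: le_lt_trans cb.
have t1 : c / b < 1 by rewrite ltr_pdivrMr // mul1r.
have t01 : 0 <= c / b <= 1 by rewrite divr_ge0 ?(ltW b0) //= ltW.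
have := Fconc _ b 0 t01; rewrite Fb !mulr0 add0r addr0 divfK ?gt_eqF//.
by move=> h; apply: lt_le_trans h; rewrite mulr_gt0 // subr_gt0.
Qed.

Lemma concave_sign_after {R : realType} (F : R -> R) (b c : R) :
  concave F -> 0 < F 0 -> F b = 0 -> 0 < b < c -> F c < 0.
Proof.
move=> Fconc F0 Fb /andP[b0 bc]; rewrite ltNge; apply/negP => Fc.
have c0 : 0 < c by exact: lt_trans bc.
have t1 : b / c < 1 by rewrite ltr_pdivrMr // mul1r.
have t0 : 0 <= b / c by rewrite divr_ge0 // ltW.
have := Fconc (b / c) c 0; rewrite t0 (ltW t1) mulr0 addr0 divfK ?gt_eqF//.
move=> /(_ isT); rewrite Fb leNgt => /negP; apply.
by apply: ltr_wpDl; [exact: mulr_ge0|apply: mulr_gt0; rewrite ?subr_gt0].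
Qed.

(** * The angle condition along the segment of directions *)

Definition slack {R : realType} {n : nat} (eps : R) (g v : 'cV[R]_n) : R :=
  - dot g v - eps * enorm g * enorm v.

Lemma slackD {R : realType} {n : nat} (eps : R) (g u v : 'cV[R]_n) :
  0 <= eps -> slack eps g u + slack eps g v <= slack eps g (u + v).
Proof.
move=> eps0; rewrite /slack dotDr.
have := ler_wpM2l (mulr_ge0 eps0 (enorm_ge0 g)) (enormD u v).
lra.
Qed.

Lemma slackZ {R : realType} {n : nat} (eps a : R) (g v : 'cV[R]_n) :
  0 <= a -> slack eps g (a *: v) = a * slack eps g v.
Proof.
by move=> a0; rewrite /slack dotZr enormZ ger0_norm //; ring.
Qed.

Lemma slackN {R : realType} {n : nat} (eps : R) (g : 'cV[R]_n) :
  slack eps g (- g) = (1 - eps) * enorm g ^+ 2.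
Proof.
by rewrite -scaleN1r /slack dotZr enormZ normrN1 -enorm_sqr; ring.
Qed.

Lemma direction0 {R : realType} {n : nat} (xi : R) (g d : 'cV[R]_n) :
  direction xi g d 0 = xi *: (- g).
Proof. by rewrite /direction scale0r sub0r subr0 mul1r scalerN. Qed.

Lemma direction1 {R : realType} {n : nat} (xi : R) (g d : 'cV[R]_n) :
  direction xi g d 1 = d.
Proof. by rewrite /direction scale1r subrr mul0r scale0r subr0. Qed.

Lemma direction_affine {R : realType} {n : nat} (xi t x y : R)
    (g d : 'cV[R]_n) :
  direction xi g d (t * x + (1 - t) * y) =
  t *: direction xi g d x + (1 - t) *: direction xi g d y.
Proof. by apply/matrixP => i j; rewrite !mxE; ring. Qed.

Lemma slack_direction_concave {R : realType} {n : nat} (eps xi : R)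
    (g d : 'cV[R]_n) :
  0 <= eps -> concave (fun beta => slack eps g (direction xi g d beta)).
Proof.
move=> eps0 t x y /andP[t0 t1]; rewrite direction_affine.
apply: le_trans (slackD _ _ _ _ eps0).
by rewrite !slackZ // subr_ge0.
Qed.

Lemma slack_direction0 {R : realType} {n : nat} (eps xi : R)
    (g d : 'cV[R]_n) :
  0 <= xi ->
  slack eps g (direction xi g d 0) = xi * (1 - eps) * enorm g ^+ 2.
Proof. by move=> xi0; rewrite direction0 slackZ // slackN mulrA. Qed.

Lemma dot_direction {R : realType} {n : nat} (xi beta : R)
    (g d v : 'cV[R]_n) :
  dot v (direction xi g d beta) = beta * dot v d - (1 - beta) * xi * dot v g.
Proof. by rewrite /direction -scaleNr dotDr !dotZr mulNr. Qed.

Lemma dot_direction_direction {R : realType} {n : nat} (xi beta : R)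
    (g d : 'cV[R]_n) :
  dot (direction xi g d beta) (direction xi g d beta) =
  beta ^+ 2 * dot d d - 2 * beta * (1 - beta) * xi * dot g d
  + (1 - beta) ^+ 2 * xi ^+ 2 * dot g g.
Proof.
rewrite dot_direction !(dotC (direction _ _ _ _)) !dot_direction (dotC d g).
ring.
Qed.

Lemma slack_direction_continuous {R : realType} {n : nat} (eps xi : R)
    (g d : 'cV[R]_n) :
  continuous (fun beta => slack eps g (direction xi g d beta)).
Proof.
(* In terms of beta, the squared norm of the direction is the polynomial [p],
   and minus its inner product with [g] is the polynomial [q]. *)
pose p : {poly R} :=
  dot d d *: 'X^2 - (2 * xi * dot g d) *: ('X * (1 - 'X))
  + (xi ^+ 2 * dot g g) *: (1 - 'X) ^+ 2.
pose q : {poly R} := - dot g d *: 'X + (xi * dot g g) *: (1 - 'X).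
have -> : (fun beta => slack eps g (direction xi g d beta)) =
          (fun beta => q.[beta] - eps * enorm g * Num.sqrt p.[beta]).
  apply/funext => beta; rewrite /slack /enorm dot_direction_direction.
  rewrite dot_direction /p /q !hornerE /=.
  by congr (_ - _ * Num.sqrt _); ring.
move=> beta; apply: cvgB; first exact: continuous_horner.
apply: cvgM; first exact: cvg_cst.
apply: continuous_comp; first exact: continuous_horner.
exact: sqrt_continuous.
Qed.

(** [angle_poly] is the difference of squares
    [(g.v)^2 - (eps |g| |v|)^2] at the direction [v]. *)
Lemma horner_angle_poly {R : realType} {n : nat} (eps xi beta : R)
    (g d : 'cV[R]_n) :
  let v := direction xi g d beta in
  (angle_poly eps xi g d).[beta] =
  slack eps g v * (slack eps g v + 2 * (eps * enorm g * enorm v)).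
Proof.
move=> v.
have -> : slack eps g v * (slack eps g v + 2 * (eps * enorm g * enorm v))
    = dot g v ^+ 2 - eps ^+ 2 * enorm g ^+ 2 * enorm v ^+ 2.
  by rewrite /slack; ring.
rewrite (enorm_sqr v) dot_direction dot_direction_direction.
rewrite /angle_poly !hornerE /= /angle_coefA /angle_coefB /angle_coefC.
rewrite -!enorm_sqr; ring.
Qed.

(** While [slack] is positive, so is the other factor of [angle_poly], which is
    at least as large; thus no root of [angle_poly] precedes the zero of [slack]. *)
Lemma smallest_root01_slack_root {R : realType} {n : nat} (eps xi b : R)
    (g d : 'cV[R]_n) :
  0 <= eps -> 0 < slack eps g (direction xi g d 0) ->
  0 < b < 1 -> slack eps g (direction xi g d b) = 0 ->
  smallest_root01 (angle_poly eps xi g d) b.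
Proof.
move=> eps0 F0 b01 Fb; split=> //.
  by rewrite /root horner_angle_poly Fb mul0r.
move=> c /andP[c0 _]; apply: contraLR; rewrite -ltNge => cb.
pose F beta := slack eps g (direction xi g d beta).
have Fc : 0 < F c.
  apply: (concave_sign_before F b) => //; last by rewrite (ltW c0).
  exact: slack_direction_concave.
rewrite /root horner_angle_poly gt_eqF // mulr_gt0 // ltr_wpDr //.
by rewrite !mulr_ge0 // enorm_ge0.
Qed.

Lemma slack_direction_root {R : realType} {n : nat} (eps xi : R)
    (g d : 'cV[R]_n) :
  0 < slack eps g (direction xi g d 0) ->
  slack eps g (direction xi g d 1) < 0 ->
  exists2 b, 0 < b < 1 & slack eps g (direction xi g d b) = 0.
Proof.
set F := fun beta => slack eps g (direction xi g d beta).
rewrite -[X in 0 < X]/(F 0) -[X in X < 0]/(F 1) => F0 F1.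
have Fcont : {within `[0, 1], continuous F}%classic.
  exact/continuous_subspaceT/slack_direction_continuous.
have F01 : Num.min (F 0) (F 1) <= 0 <= Num.max (F 0) (F 1).
  by rewrite ge_min le_max (ltW F0) (ltW F1) orbT.
have [b] := IVT ler01 Fcont F01.
rewrite in_itv /= => /andP[b0 b1] Fb; exists b => //.
rewrite !lt_neqAle b0 b1 !andbT; apply/andP; split; apply/eqP => eb.
  by subst b; rewrite Fb ltxx in F0.
by subst b; rewrite Fb ltxx in F1.
Qed.

(** As a function of [beta], [slack] is concave; its chord between 0 and 1 is
    [|g|^2] times [beta |-> (1 - beta) rho - beta pi], which vanishes at
    [rho / (rho + pi)]. *)
Lemma slack_lower_bound_ge0 {R : realType} {n : nat} (eps xi : R)
    (g d : 'cV[R]_n) :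
  let rho := xi * (1 - eps) in
  let pik := dot g d / enorm g ^+ 2 + eps * (enorm d / enorm g) in
  0 <= eps -> 0 <= xi -> 0 < enorm g -> 0 < rho -> 0 < pik ->
  0 <= slack eps g (direction xi g d (rho / (rho + pik))).
Proof.
move=> rho pik eps0 xi0 g0 rho0 pik0; set b := rho / (rho + pik).
have s0 : 0 < rho + pik by rewrite addr_gt0.
have b01 : 0 <= b <= 1.
  by rewrite divr_ge0 ?(ltW rho0) ?(ltW s0) //= ler_pdivrMr // mul1r lerDl ltW.
have := slack_direction_concave _ xi g d eps0 b 1 0 b01.
rewrite slack_direction0 // direction1 mulr1 mulr0 addr0 => chord.
apply: le_trans chord.
have -> : slack eps g d = - (pik * enorm g ^+ 2).
  by rewrite /slack /pik; field; rewrite gt_eqF.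
suff -> : b * - (pik * enorm g ^+ 2) + (1 - b) * (rho * enorm g ^+ 2) = 0 by [].
by rewrite /b; field; rewrite gt_eqF.
Qed.

Theorem theorem1 (R : realType) (n : nat) (f : 'cV[R]_n -> R) (x : 'cV[R]_n)
    (eps xi : R) (S : 'M[R]_n) (dNT : 'cV[R]_n) :
  twice_continuously_differentiable f ->
  0 < eps < 1 ->
  0 < xi ->
  S^T = S ->
  ~~ is_scalar_mx S ->
  let g := grad f x in
  S *m dNT = - g ->
  - dot g dNT < eps * enorm g * enorm dNT ->
  let P := angle_poly eps xi g dNT in
  let d := direction xi g dNT in
  (exists beta_eps : R, smallest_root01 P beta_eps) /\
  forall beta_eps : R, smallest_root01 P beta_eps ->
    [/\ - dot g (d beta_eps) = eps * enorm g * enorm (d beta_eps),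
        forall beta : R, 0 <= beta <= 1 ->
          (- dot g (d beta) >= eps * enorm g * enorm (d beta)
           <-> beta <= beta_eps)
      & let rho := xi * (1 - eps) in
        let pik := dot g dNT / enorm g ^+ 2 + eps * (enorm dNT / enorm g) in
        rho / (rho + pik) <= beta_eps].
Proof.
move=> _ /andP[eps0 eps1] xi0 _ _ g _ angle P d.
have g0 : 0 < enorm g.
  rewrite lt_neqAle enorm_ge0 andbT eq_sym; apply/eqP => gE.
  by have := dot_le_enorm g dNT; move: angle; rewrite gE; lra.
have rho0 : 0 < xi * (1 - eps) by rewrite mulr_gt0 // subr_gt0.
pose F beta := slack eps g (d beta).
have F0 : 0 < F 0.
  by rewrite /F slack_direction0 ?(ltW xi0) // mulr_gt0 // exprn_gt0.
have F1 : F 1 < 0 by rewrite /F /d direction1 /slack subr_lt0.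
have Fconc : concave F by apply: slack_direction_concave; exact: ltW.
have [b b01 Fb] := slack_direction_root _ _ _ _ F0 F1.
have Pb : smallest_root01 P b.
  by apply: smallest_root01_slack_root => //; exact: ltW.
split; first by exists b.
move=> c [c01 rootc cmin].
have {c c01 rootc cmin} -> : c = b.
  case: Pb => _ rootb bmin.
  by apply: le_anti; rewrite cmin // bmin.
have Fsign beta : 0 <= beta ->
    (- dot g (d beta) >= eps * enorm g * enorm (d beta) <-> beta <= b).
  move=> beta0; rewrite -subr_ge0 -[X in 0 <= X]/(F beta); split.
    apply: contraTT; rewrite -!ltNge => bb.
    by apply: (concave_sign_after _ b) => //; case/andP: b01 => ->.
  rewrite le_eqVlt => /predU1P[->|bb]; first by rewrite /F /d Fb.
  by apply/ltW/(concave_sign_before _ b) => //; rewrite beta0.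
split=> [|beta /andP[beta0 _]|rho pik]; last 2 first.
- exact: Fsign.
- have pik0 : 0 < pik.
    have -> : pik = (dot g dNT + eps * enorm g * enorm dNT) / enorm g ^+ 2.
      by rewrite /pik; field; rewrite gt_eqF.
    by rewrite divr_gt0 ?exprn_gt0 //; lra.
  apply/Fsign; first by rewrite divr_ge0 ?(ltW rho0) // addr_ge0 // ltW.
  by rewrite -subr_ge0; apply: slack_lower_bound_ge0 => //; exact: ltW.
by apply/eqP; rewrite -subr_eq0; apply/eqP.
Qed.
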